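(* Let $S$ be a proper numerical set. Then the following four numerical sets are all symmetric: (1) $S\boxplus_{C}\{0,2,\rightarrow\}\boxplus_{B}S^{*}$; (2) $S\boxplus_{B}\{0,2,\rightarrow\}\boxplus_{C}S^{*}$; (3) $S^{*}\boxplus_{C}\{0,2,\rightarrow\}\boxplus_{B}S$; (4) $S^{*}\boxplus_{B}\{0,2,\rightarrow\}\boxplus_{C}S$.
   Context: Write $\mathbb{N}_0=\{0,1,2,\dots\}$. A numerical set is a subset $R\subseteq\mathbb{N}_0$ containing $0$ with finite complement in $\mathbb{N}_0$; it is proper if $R\neq\mathbb{N}_0$. For proper $R$, $\mathrm{G}(R)=\mathbb{N}_0\setminus R$ is the set of gaps, $\mathrm{F}(R)=\max \mathrm{G}(R)$ the Frobenius number, and $\mathrm{C}(R)=\mathrm{F}(R)+1$ the conductor. The notation $R=\{0,r_1,\dots,r_n,\rightarrow\}$ means that $0<r_1<\dots<r_{n-1}<r_n=\mathrm{C}(R)$ are all the elements of $R$ that are $\le\mathrm{C}(R)$, and that all integers greater than $\mathrm{C}(R)$ also belong to $R$. Thus $\{0,2,\rightarrow\}=\mathbb{N}_0\setminus\{1\}$. A numerical set $R$ is symmetric if for every integer $a$ with $0\le a\le \mathrm{F}(R)$ exactly one of $a$ and $\mathrm{F}(R)-a$ belongs to $R$. The dual of a proper numerical set $S$ is the numerical set $S^{*}=\{\mathrm{F}(S)-a : a\in \mathrm{G}(S)\}\cup\{x\in\mathbb{N}_0: x\ge \mathrm{C}(S)\}$. For proper numerical sets $R=\{0,r_1,\dots,r_n=\mathrm{C}(R),\rightarrow\}$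 and $S=\{0,s_1,\dots,s_m=\mathrm{C}(S),\rightarrow\}$ define the bonded sum $R\boxplus_{B}S=\{0,r_1,\dots,r_{n-1},r_n-1,s_1+r_n-1,\dots,s_m+r_n-1,\rightarrow\}$ and the conjoint sum $R\boxplus_{C}S=\{0,r_1,\dots,r_{n-1},s_1+r_n-1,\dots,s_m+r_n-1,\rightarrow\}$. Expressions with several of these operations are evaluated from left to right. *)

(* Defs.v *)
From mathcomp Require Import all_boot finmap.
From mathcomp Require Import mathcomp_extra boolp classical_sets functions cardinality.
Set Implicit Arguments.
Unset Strict Implicit.
Unset Printing Implicit Defensive.

Local Open Scope nat_scope.
Local Open Scope classical_set_scope.

Definition gaps (R : set nat) : set nat := ~` R.

Definition numerical_set (R : set nat) : Prop := R 0 /\ finite_set (gaps R).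

Definition proper_numerical_set (R : set nat) : Prop :=
  numerical_set R /\ R <> setT.

(* Meaningful only when the gaps form a nonempty finite set: the maximum of the
   empty set is 0, and [fset_set] of an infinite set is empty. *)
Definition frobenius (R : set nat) : nat := \max_(x <- fset_set (gaps R)) x.

Definition conductor (R : set nat) : nat := (frobenius R).+1.

(* Properness is part of the definition because the Frobenius number is only
   defined for proper numerical sets. *)
Definition symmetric_numset (R : set nat) : Prop :=
  proper_numerical_set R /\
  forall a : nat, a <= frobenius R ->
    (R a /\ ~ R (frobenius R - a)) \/ (~ R a /\ R (frobenius R - a)).

(* The subtraction is not truncated: a gap is at most the Frobenius number. *)
Definition dual_numset (S : set nat) : set nat :=
  [set frobenius S - a | a in gaps S] `|` [set x | conductor S <= x].

(* For R = {0, r_1, ..., r_n, ->} with r_n = conductor R, the elements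
   0, r_1, ..., r_(n-1) are [below R] and s_1, ..., s_m are [listed S]. *)
Definition below (R : set nat) : set nat := [set x | R x /\ x < conductor R].

Definition listed (S : set nat) : set nat :=
  [set s | S s /\ 0 < s <= conductor S].

Definition bonded_sum (R S : set nat) : set nat :=
  below R `|` [set conductor R - 1]
  `|` [set s + (conductor R - 1) | s in listed S]
  `|` [set x | conductor S + (conductor R - 1) < x].

Definition conjoint_sum (R S : set nat) : set nat :=
  below R
  `|` [set s + (conductor R - 1) | s in listed S]
  `|` [set x | conductor S + (conductor R - 1) < x].

Notation "R \bsum S" := (bonded_sum R S) (at level 50, left associativity).
Notation "R \csum S" := (conjoint_sum R S) (at level 50, left associativity).

(* {0, 2, ->} *)
Definition numset02 : set nat := ~` [set 1].

(* Main.v *)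
Require Import Defs.
From mathcomp Require Import all_boot finmap zify.
From mathcomp Require Import mathcomp_extra boolp classical_sets functions cardinality.

(** Let F be the Frobenius number of S.  A sum of R and T is R up to the
    Frobenius number of R followed by a copy of T translated by that number;
    the two sums differ only at the junction point itself, which belongs to
    the bonded sum and not to the conjoint one ([bonded_sumP],
    [conjoint_sumP]).  Hence Frobenius numbers add, and each of the four sets
    has Frobenius number F + 1 + F.

    All four sets are S or its dual below F, and the other one translated by
    F + 1 above F + 1; the middle summand only decides the two central points
    F and F + 1, of which it makes exactly one a member.  The reflection
    a |-> 2F + 1 - a exchanges these two points, and sends the point a < F to
    the point F - a of the translated copy.  Symmetry therefore amounts to the
    fact that a belongs to one of S, S^* if and only if F - a does not belong
    to the other.  This relation between S and its dual is itself symmetric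
    ([mirrored_sym]), so that cases (3) and (4) are cases (1) and (2) with the
    roles exchanged. *)

Set Implicit Arguments.
Unset Strict Implicit.
Unset Printing Implicit Defensive.

Local Open Scope nat_scope.
Local Open Scope classical_set_scope.

(** * Frobenius numbers *)

Lemma proper_frobeniusP (R : set nat) : proper_numerical_set R ->
  [/\ R 0, ~ R (frobenius R) & forall x, frobenius R < x -> R x].
Proof.
move=> [[R0 finG] RT].
have gapsP x : (x \in fset_set (gaps R)) = (x \in gaps R) by rewrite in_fset_set.
have le_frob x : ~ R x -> x <= frobenius R.
  move=> Rx; have xG : x \in fset_set (gaps R) by rewrite gapsP inE.
  exact: (@leq_bigmax_seq _ (enum_fset _) xpredT id x xG).
split=> // [|x ltFx]; last first.
  by apply: contrapT => /le_frob; rewrite leqNgt ltFx.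
have [g Rg] : exists g, ~ R g.
  by apply/existsNP => allR; apply: RT; apply/seteqP; split.
(* The maximum is either a gap or the default value 0; in the latter case the
   gap g, being at most 0, would be 0, which lies in R. *)
have : frobenius R = 0 \/ ~ R (frobenius R).
  rewrite /frobenius big_seq.
  apply: (big_ind (fun m => m = 0 \/ ~ R m)) => [|x y Px Py|x]; first by left.
  - by rewrite /maxn; case: ifP.
  - by rewrite gapsP inE; right.
case=> // F0; have := le_frob _ Rg; rewrite F0 leqn0 => /eqP g0.
by move: Rg; rewrite g0.
Qed.

(** Being the last gap determines the Frobenius number, so that no maximum has
    to be computed for the sums and the dual. *)
Lemma frobenius_unique (R : set nat) (F : nat) :
  R 0 -> ~ R F -> (forall x, F < x -> R x) ->
  proper_numerical_set R /\ frobenius R = F.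
Proof.
move=> R0 RF gtF.
have properR : proper_numerical_set R.
  split; last by move=> RT; apply: RF; rewrite RT.
  split=> //; apply: (@sub_finite_set _ _ `I_F.+1); last exact: finite_II.
  by move=> x /= Rx; rewrite ltnNge; apply/negP => /gtF.
split=> //; have [_ RfR gtfR] := proper_frobeniusP properR.
by case: (ltngtP (frobenius R) F) => // [/gtfR|/gtF].
Qed.

Lemma numset02_frobenius :
  proper_numerical_set numset02 /\ frobenius numset02 = 1.
Proof.
by apply: frobenius_unique => [|/(_ erefl)|x ltx] // xE; move: ltx; rewrite xE.
Qed.

(** * Sums as juxtapositions *)

Section Sums.
Variables R S : set nat.
Hypotheses (properR : proper_numerical_set R) (properS : proper_numerical_set S).

(** The listed elements of [S] and the final ray together are the positive
    elements of [S]; both sums contain their translates. *)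
Lemma translated_listedP x : frobenius R < x ->
  ([set s + (conductor R - 1) | s in listed S] x \/
   conductor S + (conductor R - 1) < x) <-> S (x - frobenius R).
Proof.
move=> ltFx; have [_ _ gtS] := proper_frobeniusP properS.
rewrite /conductor subn1 /=; split.
  case=> [[s [Ss _] <-]|ltx]; first by rewrite addnK.
  by apply: gtS; lia.
move=> Sx; have [lex|ltx] := leqP x ((frobenius S).+1 + frobenius R); last by right.
left; exists (x - frobenius R); last by lia.
by split=> //; rewrite /conductor; lia.
Qed.

(** The junction point [frobenius R] falls in the second branch, where it is
    the translate of 0. *)
Lemma bonded_sumP x :
  (R \bsum S) x <-> if x < frobenius R then R x else S (x - frobenius R).
Proof.
have [_ RF _] := proper_frobeniusP properR.
have [S0 _ _] := proper_frobeniusP properS.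
rewrite /bonded_sum /below /=; case: (ltngtP x (frobenius R)) => [ltx|gtx|->].
- split; last by move=> Rx; do 3 left; split=> //; rewrite /conductor; lia.
  case=> [[[[]|]|[s [_ /andP[s0 _]]]]|] //; rewrite /conductor; lia.
- rewrite -translated_listedP //; split; last by case; [left; right|right].
  case=> [[[[_]|]|]|]; last by right.
  + by rewrite /conductor; lia.
  + by rewrite /conductor; lia.
  + by left.
- rewrite subnn; split=> // _; left; left; right.
  by rewrite /conductor subn1.
Qed.

Lemma conjoint_sumP x :
  (R \csum S) x <-> if x <= frobenius R then R x else S (x - frobenius R).
Proof.
rewrite /conjoint_sum /below /=; case: (leqP x (frobenius R)) => [lex|gtx].
- split; last by move=> Rx; do 2 left; split=> //; rewrite /conductor; lia.
  case=> [[[]|[s [_ /andP[s0 _]]]]|] //; rewrite /conductor; lia.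
- rewrite -translated_listedP //; split; last by case; [left; right|right].
  case=> [[[_]|]|]; last by right.
  + by rewrite /conductor; lia.
  + by left.
Qed.

Lemma bonded_sum_frobenius : proper_numerical_set (R \bsum S) /\
  frobenius (R \bsum S) = frobenius R + frobenius S.
Proof.
have [R0 _ _] := proper_frobeniusP properR.
have [S0 SF gtS] := proper_frobeniusP properS.
apply: frobenius_unique => [||x ltx]; rewrite bonded_sumP.
- by case: ifP.
- by rewrite ltnNge leq_addr addKn.
- by rewrite ifF; [apply: gtS|]; lia.
Qed.

Lemma conjoint_sum_frobenius : proper_numerical_set (R \csum S) /\
  frobenius (R \csum S) = frobenius R + frobenius S.
Proof.
have [R0 RF _] := proper_frobeniusP properR.
have [S0 SF gtS] := proper_frobeniusP properS.
have S_gt0 : 0 < frobenius S.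
  by rewrite lt0n; apply/eqP => F0; apply: SF; rewrite F0.
apply: frobenius_unique => [||x ltx]; rewrite conjoint_sumP.
- by rewrite leq0n.
- by rewrite ifF ?addKn //; lia.
- by rewrite ifF; [apply: gtS|]; lia.
Qed.

End Sums.

(** * Duality *)

(** The relation between a set and its dual on which symmetry rests.  Unlike the
    formula for the dual, it treats both sides alike, so that one argument
    serves for both orders of the outer summands. *)
Definition mirrored (R A : set nat) : Prop :=
  [/\ proper_numerical_set R, proper_numerical_set A,
      frobenius A = frobenius R
    & forall a, a <= frobenius R -> A (frobenius R - a) <-> ~ R a].

Lemma mirrored_sym R A : mirrored R A -> mirrored A R.
Proof.
move=> [properR properA FE RA]; split=> //; rewrite FE => a lea.
by rewrite -{2}(subKn lea) RA ?leq_subr // notK.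
Qed.

Lemma mirrored_dual S : proper_numerical_set S -> mirrored S (dual_numset S).
Proof.
move=> properS; have [S0 SF gtS] := proper_frobeniusP properS.
have dualP a : a <= frobenius S -> dual_numset S (frobenius S - a) <-> ~ S a.
  move=> lea; split; last by move=> Sa; left; exists a.
  case=> [[b Sb bE]|]; last by rewrite /= /conductor; lia.
  have leb : b <= frobenius S by rewrite leqNgt; apply/negP => /gtS.
  by have <- : b = a by lia.
have [properD FE] : proper_numerical_set (dual_numset S) /\
    frobenius (dual_numset S) = frobenius S.
  apply: frobenius_unique => [||x ltx]; last by right.
  - by rewrite -(subnn (frobenius S)) dualP.
  - by have := dualP 0 isT; rewrite subn0 => -> /(_ S0).
by split.
Qed.

(** * Symmetry *)

(** A set [T] with odd Frobenius number 2m + 1 need only be tested on the points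
    at most m, since the reflection exchanges them with the others. *)
Lemma symmetric_lower_half (T : set nat) (m : nat) :
  proper_numerical_set T -> frobenius T = m + 1 + m ->
  (forall a, a <= m -> T (m + 1 + m - a) <-> ~ T a) -> symmetric_numset T.
Proof.
move=> properT FT lowT; split=> // a; rewrite FT => lea.
have [lea1|gta] := leqP a m.
  by rewrite lowT // notK; case: (EM (T a)); [left|right].
set b := m + 1 + m - a.
have leb : b <= m by rewrite /b; lia.
have -> : a = m + 1 + m - b by rewrite /b; lia.
by rewrite lowT // notK; case: (EM (T b)); [right|left].
Qed.

(** With a middle summand of Frobenius number 1, the copy of [A] is translated
    by [frobenius R + 1]; the lower half is then exactly [R] up to its Frobenius
    number, and its reflection the copy of [A] up to the same number. *)
Lemma conjoint_bonded_symmetric R A : mirrored R A ->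
  symmetric_numset (R \csum numset02 \bsum A).
Proof.
move=> [properR properA FA RA].
have [proper2 F2] := numset02_frobenius.
have [properT FT] := conjoint_sum_frobenius properR proper2.
have [properU FU] := bonded_sum_frobenius properT properA.
apply: (symmetric_lower_half (m := frobenius R)) => // [|a lea].
  by rewrite FU FT F2 FA.
rewrite !bonded_sumP // FT F2 ifF; last by lia.
rewrite ifT; last by lia.
by rewrite conjoint_sumP // lea -addnBA // addKn RA.
Qed.

(** Below the Frobenius number this is the previous argument; only the two
    central points have changed. *)
Lemma bonded_conjoint_symmetric R A : mirrored R A ->
  symmetric_numset (R \bsum numset02 \csum A).
Proof.
move=> [properR properA FA RA].
have [proper2 F2] := numset02_frobenius.
have [properT FT] := bonded_sum_frobenius properR proper2.
have [properU FU] := conjoint_sum_frobenius properT properA.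
apply: (symmetric_lower_half (m := frobenius R)) => // [|a].
  by rewrite FU FT F2 FA.
rewrite leq_eqVlt => /predU1P[->|lta]; rewrite !conjoint_sumP // FT F2.
  (* The central points escape the duality of R and A: F is a member although
     F is not in R, and F + 1 is a gap although 0 is in A. *)
  rewrite addnK leqnn leq_addr !bonded_sumP // ltnn ltnNge leq_addr /=.
  by rewrite subnn addKn; split=> [/(_ erefl)|[]].
rewrite ifF; last by lia.
rewrite ifT; last by lia.
by rewrite bonded_sumP // lta -addnBA ?(ltnW lta) // addKn RA // ltnW.
Qed.

Theorem lemma5p2 (S : set nat) (hS : proper_numerical_set S) :
  [/\ symmetric_numset (S \csum numset02 \bsum dual_numset S),
      symmetric_numset (S \bsum numset02 \csum dual_numset S),
      symmetric_numset (dual_numset S \csum numset02 \bsum S)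
    & symmetric_numset (dual_numset S \bsum numset02 \csum S)].
Proof.
have SD := mirrored_dual hS; have DS := mirrored_sym SD.
by split; [exact: conjoint_bonded_symmetric | exact: bonded_conjoint_symmetric
  | exact: conjoint_bonded_symmetric | exact: bonded_conjoint_symmetric].
Qed.
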